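(* For every integer $n\ge0$, $$E_n(q) =\sum_{m=0}^n\frac{1+(-1)^{n-m}}{2}\,[m]_q! \sum_{k=0}^{\lfloor m/2\rfloor} \frac{(-1)^{\frac{n-m}{2}+k} (1-q)^{2\lfloor m/2\rfloor} [m-2k+1]_q^{2\lfloor n/2\rfloor} q^{A_{m,k}}} {(q^2;q^2)_k\, (q^2;q^2)_{\lfloor m/2\rfloor-k}\, (q^{2(m-2k+2)};q^2)_k\, (q^{2(\lfloor (m+1)/2\rfloor-k+1)};q^2)_{\lfloor m/2\rfloor-k}},$$ where $A_{m,k}=k^2+k(n-m+1) - \frac{n-m}{2} + \lfloor m/2\rfloor^2 -m \lfloor n/2\rfloor$.
   Context: $E_n(q)=\sum_{\sigma\in\mathfrak{A}_n}q^{(31\text{-}2)\sigma}$, where $\mathfrak{A}_n$ is the set of falling alternating permutations $\sigma=\sigma_1\cdots\sigma_n$ of $[n]$ (i.e. $\sigma_1>\sigma_2<\sigma_3>\cdots$; $E_0(q)=1$) and $(31\text{-}2)\sigma=\#\{(i,j): i+1<j,\ \sigma_i>\sigma_j>\sigma_{i+1}\}$. $[m]_q=1+q+\cdots+q^{m-1}$, $[m]_q!=\prod_{i=1}^m[i]_q$, and $(a;q^2)_k=\prod_{i=0}^{k-1}(1-aq^{2i})$ (empty product $=1$). *)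

(* Defs.v *)
From HB Require Import structures.
From mathcomp Require Import all_boot all_order all_algebra all_fingroup.
From mathcomp Require Import fraction.
Set Implicit Arguments. Unset Strict Implicit. Unset Printing Implicit Defensive.
Import Order.TTheory GRing.Theory Num.Theory.
Local Open Scope ring_scope.

(* Permutations of [n] are represented by s : 'S_n (values 0..n-1 instead of
   1..n, an order-preserving relabelling). Positions are 0-indexed. *)

(* falling alternating: s_1 > s_2 < s_3 > ... ; with 0-indexed positions,
   s i > s (i+1) for i even, s i < s (i+1) for i odd. *)
Definition falling_alt (n : nat) (s : 'S_n) : bool :=
  [forall i : 'I_n, forall j : 'I_n,
     (nat_of_ord j == i.+1) ==>
       (if odd i then (s i < s j)%N else (s j < s i)%N)].

(* (31-2) s = #{(i,j) : i+1 < j, s_i > s_j > s_{i+1}}; the triple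
   (i, i', j) with i' = i+1 encodes the pair (i, j). *)
Definition pat31_2 (n : nat) (s : 'S_n) : nat :=
  #|[set t : 'I_n * 'I_n * 'I_n |
      [&& nat_of_ord t.1.2 == t.1.1.+1, (t.1.2 < t.2)%N,
          (s t.2 < s t.1.1)%N & (s t.1.2 < s t.2)%N]]|.

Definition En (n : nat) : {poly rat} :=
  \sum_(s : 'S_n | falling_alt s) 'X^(pat31_2 s).

Definition qint {R : pzRingType} (q : R) (m : nat) : R := \sum_(i < m) q ^+ i.
Definition qfact {R : pzRingType} (q : R) (m : nat) : R :=
  \prod_(i < m) qint q i.+1.
Definition qpoch {R : pzRingType} (a b : R) (k : nat) : R :=
  \prod_(i < k) (1 - a * b ^+ i).

(* The exponent A_{m,k} (with (n-m)/2 read as (n-m)./2; only relevant when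
   n - m is even, otherwise the term is multiplied by 0). *)
Definition Aexp (n m k : nat) : int :=
  (k ^ 2 + k * (n - m + 1) + (m./2) ^ 2)%:Z - ((n - m)./2)%:Z
  - (m * n./2)%:Z.

Definition En_rhs {F : fieldType} (q : F) (n : nat) : F :=
  \sum_(m < n.+1)
    (1 + (-1) ^+ (n - m)) / 2 * qfact q m *
    \sum_(k < (m./2).+1)
      ((-1) ^+ ((n - m)./2 + k) * (1 - q) ^+ (2 * m./2)
       * qint q (m - 2 * k + 1) ^+ (2 * n./2) * q ^ (Aexp n m k))
      / (qpoch (q ^+ 2) (q ^+ 2) k
         * qpoch (q ^+ 2) (q ^+ 2) (m./2 - k)
         * qpoch (q ^+ (2 * (m - 2 * k + 2))) (q ^+ 2) k
         * qpoch (q ^+ (2 * ((m.+1)./2 - k + 1))) (q ^+ 2) (m./2 - k)).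

Definition toF (p : {poly rat}) : {fraction {poly rat}} := FracField.tofrac p.

(* Main.v *)
(** Deleting the first letter of an alternating permutation lowers (31-2) by
    sigma_1 - sigma_2 - 1 if sigma_1 > sigma_2 and by 0 otherwise.  This gives a
    q-analogue of the boustrophedon recursion, and E_n(q) is one of its entries.
    Let x = (qs + 1/s)/(1-q) and y = (s + 1/s)/(1-q), so that
    y - x = s and x - qy = 1/s.  If L is the linear functional on Laurent
    polynomials in s with L(x^N) = L(s y^N) = [N = 0], then L(x^k y^(n-k)) and
    L(s x^k y^(n-k)) satisfy the same recursion, whence E_n(q) = L(y^n).
    Let R_m = ((1-q) y)^(m mod 2) prod_a (1 + a s^2)(1 + a/s^2), where a = q^j
    and j runs through the integers 0 < j < m of parity opposite to m; each
    factor of the product is a constant multiple of y^2 - z_a, z_a a constant.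
    As y R_m is a polynomial in y and R_m (1 + q^(m+1) s^2)(1 + 1/(q s^2)) one in
    x, both without constant term, L kills s y R_m and the latter, and this forces
    L(R_(m+2)) = (1 - q^(m+1)) (1 - q^(m+2)) L(R_m), so L(R_m) is (1-q)^m [m]_q!.
    The theorem is then the Newton interpolation of (y^2)^(n/2) at the nodes z_a,
    the inner sum over k being the divided difference. *)
Require Import Defs.
From HB Require Import structures.
From mathcomp Require Import all_boot all_order all_algebra all_fingroup.
From mathcomp Require Import fraction.
From mathcomp Require Import ring zify.
Import Order.TTheory GRing.Theory Num.Theory.
Local Open Scope ring_scope.

(** * Alternating permutations and deletion of the first letter *)

(** Deleting the first letter exchanges the falling and the rising type, hence the flag. *)
Definition alternating (rising : bool) {n : nat} (s : 'S_n) : bool :=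
  [forall i : 'I_n, forall j : 'I_n,
     (nat_of_ord j == i.+1) ==>
       (if odd i (+) rising then (s i < s j)%N else (s j < s i)%N)].

Lemma falling_altE (n : nat) (s : 'S_n) : falling_alt s = alternating false s.
Proof.
by apply: eq_forallb => i; apply: eq_forallb => j; rewrite addbF.
Qed.

Lemma alternating_nil_or_single (p : bool) (n : nat) (s : 'S_n) :
  (n <= 1)%N -> alternating p s.
Proof.
move=> le_n1; apply/forallP => i; apply/forallP => j; apply/implyP => /eqP ji.
by have := ltn_ord j; rewrite ji ltnNge (leq_trans le_n1).
Qed.

Lemma ltn_bump2 (h i j : nat) : (bump h i < bump h j)%N = (i < j)%N.
Proof. by rewrite !ltnNge leq_bump2. Qed.

(** [lift_perm ord0 k t] puts [k] in front of [t] and raises the letters of [t] that are at least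
    [k]; so a first ascent means [k <= t ord0], with equality allowed. *)
Lemma alternating_lift_perm (p : bool) (n : nat) (k : 'I_n.+2) (t : 'S_n.+1) :
  alternating p (lift_perm ord0 k t) =
    (if p then (k <= t ord0)%N else (t ord0 < k)%N) && alternating (~~ p) t.
Proof.
have lift1 : (lift ord0 (ord0 : 'I_n.+1) : 'I_n.+2) = 1%N :> nat by [].
apply/forallP/andP => [alt_s | [k_t0 /forallP alt_t] i].
  split.
    have /forallP/(_ (lift ord0 ord0)) := alt_s ord0.
    rewrite lift1 eqxx /= lift_perm_id lift_perm_lift /= /bump.
    by case: p {alt_s}; case: leqP => //=; lia.
  apply/forallP => i; apply/forallP => j; apply/implyP => /eqP ji.
  have /forallP/(_ (lift ord0 j)) := alt_s (lift ord0 i).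
  rewrite /= /bump /= !add1n ji eqxx /= !lift_perm_lift !ltn_bump2.
  by rewrite addbN addNb.
apply/forallP => j; apply/implyP => /eqP.
case: (unliftP ord0 i) => [i'|] ->; case: (unliftP ord0 j) => [j'|] -> //=.
  rewrite /bump !add1n => -[ji]; rewrite !lift_perm_lift /= !ltn_bump2.
  have /forallP/(_ j') := alt_t i'; rewrite ji eqxx /=.
  by rewrite addbN addNb.
rewrite /bump add1n lift_perm_id lift_perm_lift /= => -[j0].
have -> : j' = ord0 by apply: val_inj.
by case: p {alt_t} k_t0; rewrite /bump; case: leqP => //=; lia.
Qed.

Lemma pat31_2_sum (n : nat) (s : 'S_n) :
  pat31_2 s = (\sum_(i < n) \sum_(i' < n) \sum_(j < n)
    [&& i' == i.+1 :> nat, i' < j, s j < s i & s i' < s j])%N.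
Proof.
rewrite /pat31_2 -sum1dep_card big_mkcond pair_big pair_big /=.
by apply: eq_bigr => -[[i i'] j] _ /=; case: ifP.
Qed.

Lemma card_ord_between (n a b : nat) : (b <= n)%N ->
  (\sum_(v < n) ((v < b) && (a < v)))%N = (b - a.+1)%N.
Proof.
move=> le_bn; rewrite -(big_mkord predT (fun v => nat_of_bool ((v < b) && (a < v))))%N.
have tail0 : (\sum_(b <= v < n) ((v < b) && (a < v)) = 0)%N.
  by rewrite big_nat big1 // => v /andP[/leq_gtF ->].
rewrite (big_cat_nat (leq0n b) le_bn) /= tail0 addn0.
elim: b {le_bn tail0} => [|b IH]; first by rewrite big_geq.
rewrite big_nat_recr //= ltnSn /= subSS.
rewrite (eq_big_nat _ _ (F2 := fun v => nat_of_bool ((v < b) && (a < v))%N)); last first.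
  by move=> v /andP[_ lt_vb]; rewrite lt_vb ltnS ltnW.
by rewrite IH; case: (ltnP a b); lia.
Qed.

(** Only the pairs with i = 0 are new. After a descent they correspond to the values strictly
    between the first two letters, all of which occur later; after an ascent there are none, and the
    truncated subtraction gives 0. *)
Lemma pat31_2_lift_perm (n : nat) (k : 'I_n.+2) (t : 'S_n.+1) :
  pat31_2 (lift_perm ord0 k t) = ((k - (t ord0).+1) + pat31_2 t)%N.
Proof.
set s := lift_perm ord0 k t.
have s0 : s ord0 = k by rewrite /s lift_perm_id.
rewrite !pat31_2_sum big_ord_recl; congr (_ + _)%N.
  rewrite (bigD1 (lift ord0 ord0)) //= [X in (_ + X)%N]big1 ?addn0; last first.
    move=> i' ne; rewrite big1 // => j _.
    suff -> : (i' == 1 :> nat)%N = false by [].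
    by apply: contraNF ne => /eqP i1; apply/eqP/val_inj.
  (* The sum over positions [j] becomes one over values [v = s j]; at positions 0 and 1 a strict
     inequality fails. *)
  transitivity (\sum_(v < n.+2) ((v < k) && (s (lift ord0 ord0) < v)))%N.
    rewrite [RHS](reindex_inj (@perm_inj _ s)) /=; apply: eq_bigr => j _.
    rewrite s0 /bump /=; case: ltnP => //= le_j1.
    case: (unliftP ord0 j) le_j1 => [j'|] -> /=; last by rewrite s0 ltnn.
    rewrite /bump add1n ltnS leqn0 => /eqP j0.
    have -> : j' = ord0 by apply: val_inj.
    by rewrite ltnn andbF.
  rewrite card_ord_between; last exact: ltnW.
  by rewrite /s lift_perm_lift /= /bump; case: leqP => /=; lia.
apply: eq_bigr => i _; rewrite big_ord_recl /= big1 ?add0n; last by [].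
apply: eq_bigr => i' _; rewrite big_ord_recl /= andbF add0n.
apply: eq_bigr => j _; rewrite /s !lift_perm_lift /= !ltn_bump2.
by rewrite /bump !add1n eqSS.
Qed.

Lemma big_lift_perm (V : nmodType) (n : nat) (F : 'S_n.+1 -> V) :
  \sum_s F s = \sum_(k < n.+1) \sum_(t : 'S_n) F (lift_perm ord0 k t).
Proof.
rewrite pair_big /= (reindex (fun kt : 'I_n.+1 * 'S_n => lift_perm ord0 kt.1 kt.2)) //=.
(* Injectivity suffices, since both sides have (n+1)! elements. *)
apply: onW_bij; apply: inj_card_bij => [[k t] [k' t'] /= eq_s|]; last first.
  by rewrite card_prod card_ord !card_Sn factS.
have eq_k : k = k' by rewrite -(lift_perm_id ord0 k t) eq_s lift_perm_id.
congr (_, _) => //; apply/permP => i; apply: (@lift_inj _ k).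
by rewrite -(lift_perm_lift ord0 k t) eq_s lift_perm_lift eq_k.
Qed.

(** * Enumeration by first letter: the q-boustrophedon recursion *)

Section FirstLetter.
Variables (R : comPzRingType) (q : R).

(** A q-analogue of the Entringer numbers. The index [n] stands for n+1 letters, so that a first
    letter always exists. *)
Definition first_letter_enum (p : bool) (n k : nat) : R :=
  \sum_(s : 'S_n.+1 | alternating p s && (s ord0 == k :> nat))
    q ^+ pat31_2 s.

Lemma first_letter_enum00 (p : bool) : first_letter_enum p 0 0 = 1.
Proof.
rewrite /first_letter_enum (big_pred1 1%g) => [|s]; last first.
  rewrite alternating_nil_or_single // ord1 /=; apply/esym/eqP/permP => i.
  by rewrite perm1 !ord1.
by rewrite pat31_2_sum big_ord1 big_ord1 big_ord1.
Qed.

Lemma first_letter_enumS (p : bool) (n k : nat) : (k < n.+2)%N ->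
  first_letter_enum p n.+1 k =
    \sum_(l < n.+1 | if p then (k <= l)%N else (l < k)%N)
       q ^+ (k - l.+1) * first_letter_enum (~~ p) n l.
Proof.
move=> lt_k; rewrite /first_letter_enum big_mkcond big_lift_perm /=.
rewrite (bigD1 (Ordinal lt_k)) //= [X in _ + X]big1 ?addr0; last first.
  move=> k' ne_k; rewrite big1 // => t _; rewrite lift_perm_id.
  suff -> : (k' == k :> nat) = false by rewrite andbF.
  by apply: contraNF ne_k => /eqP kk'; apply/eqP/val_inj.
rewrite (eq_bigr (fun t : 'S_n.+1 =>
    if (if p then (k <= t ord0)%N else (t ord0 < k)%N) && alternating (~~ p) t
    then q ^+ ((k - (t ord0).+1) + pat31_2 t) else 0)) => [|t _]; last first.
  by rewrite lift_perm_id eqxx andbT alternating_lift_perm pat31_2_lift_perm.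
rewrite -big_mkcond /= (partition_big (fun t : 'S_n.+1 => t ord0)
  (fun l => if p then (k <= l)%N else (l < k)%N)) => [|t /andP[] //].
apply: eq_bigr => l k_l; rewrite big_distrr /=; apply: eq_big => t.
  by rewrite val_eqE; case: eqP => [->|_]; rewrite ?andbF // k_l.
by case/andP=> _ /eqP ->; rewrite exprD.
Qed.

(** Prepending the least letter to a falling alternating permutation makes it rising and creates no
    new pattern. *)
Lemma sum_falling_alt_first_letter (n : nat) :
  \sum_(s : 'S_n | falling_alt s) q ^+ pat31_2 s =
    first_letter_enum true n 0.
Proof.
under eq_bigl do rewrite falling_altE.
case: n => [|n].
  rewrite first_letter_enum00 (big_pred1 1%g) => [|s].
    by rewrite pat31_2_sum big_ord0.
  rewrite alternating_nil_or_single //; apply/esym/eqP/permP.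
  by case.
rewrite first_letter_enumS // (partition_big (fun t : 'S_n.+1 => t ord0) predT) //=.
apply: eq_bigr => l _; rewrite sub0n mul1r.
by apply: eq_bigl => t; congr (_ && _).
Qed.

End FirstLetter.

(** * The moment functional *)

Section MomentFunctional.
Variables (F : fieldType) (q : F).

(* xfactor, yfactor are (1-q) s x and (1-q) s y with s := 'X. *)
Definition xfactor : {poly F} := 1 + q%:P * 'X^2.
Definition yfactor : {poly F} := 1 + 'X^2.

Lemma size_xfactor_exp (N : nat) : (size (xfactor ^+ N) <= (2 * N).+1)%N.
Proof.
apply: leq_trans (size_poly_exp_leq _ _) _; rewrite ltnS leq_mul2r orbC.
have : (size xfactor <= 3)%N.
  rewrite (leq_trans (size_polyD _ _)) // geq_max size_poly1 /=.
  by rewrite mul_polyC (leq_trans (size_scale_leq _ _)) // size_polyXn.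
by case: (size _) => [|m] //= le_m; apply/orP; left.
Qed.

Lemma size_yfactor_exp (N : nat) : size (yfactor ^+ N) = (2 * N).+1.
Proof.
have -> : yfactor = 'X^2 + 1%:P by rewrite /yfactor addrC.
have sz3 := @size_XnaddC F 2 1 isT.
have := size_exp ('X^2 + 1%:P : {poly F}) N; rewrite sz3 /= => <-.
by rewrite prednK // lt0n size_poly_eq0 expf_neq0 // -size_poly_eq0 sz3.
Qed.

Lemma yfactor_exp_monic (N : nat) : yfactor ^+ N \is monic.
Proof.
apply: monic_exp; rewrite monicE /yfactor addrC lead_coefDl ?lead_coefXn //.
by rewrite size_poly1 size_polyXn.
Qed.

(* To avoid negative exponents, a Laurent polynomial of order at least -K is
   represented by its product with 'X^K, with K large enough. *)
Definition moment_functional (K : nat) (L : {poly F} -> F) : Prop :=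
  [/\ forall c (f g : {poly F}), L (c%:P * f + g) = c * L f + L g,
      forall N d, (N + d = K)%N -> L ('X^d * xfactor ^+ N) = (N == 0%N)%:R
    & forall N d, (N + d = K)%N -> L ('X^(d.+1) * yfactor ^+ N) = (N == 0%N)%:R].

(** Passing from K to K+1 frees the coefficients of degree 0 and 2K+3 and adds the two conditions
    with d = 0. The first new condition involves only the former coefficient and the second only the
    latter, each with factor 1; conditions with d > 0 reduce to level K on division by ['X]. *)
Lemma moment_functional_exists (K : nat) : exists L, moment_functional K L.
Proof.
elim: K => [|K [L [linL Lx Ly]]].
  exists (fun f : {poly F} => f`_0 + f`_1); split=> [c f g|N d|N d].
  - by rewrite !coefD !coefCM; ring.
  - by case: N d => [|//] [|//] _; rewrite expr0 mulr1 !coef1 addr0.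
  - by case: N d => [|//] [|//] _; rewrite expr0 mulr1 !coefX add0r.
(* [M] applies the old functional to the coefficients of degree 1 to 2K+2, shifted down by one. *)
pose M f := L (drop_poly 1 (take_poly (2 * K + 3) f)).
pose al := - M (xfactor ^+ K.+1).
pose be := - M ('X * yfactor ^+ K.+1).
exists (fun f : {poly F} => al * f`_0 + be * f`_(2 * K + 3) + M f).
have shift (g : {poly F}) : (size g <= 2 * K + 2)%N ->
    al * ('X * g)`_0 + be * ('X * g)`_(2 * K + 3) + M ('X * g) = L g.
  move=> sz_g; rewrite !coefXM addn3 /= nth_default; last by rewrite -addn2.
  rewrite !mulr0 !add0r /M take_poly_id; last first.
    by rewrite (leq_trans (size_polyMleq _ _)) // size_polyX; lia.
  by rewrite mulrC -['X]expr1 drop_polyMXn_id.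
have size_XnM d (g : {poly F}) : (size ('X^d * g : {poly F})%R <= d + size g)%N.
  by rewrite (leq_trans (size_polyMleq _ _)) // size_polyXn.
split=> [c f g|N [|d] NdK|N [|d] NdK].
- by rewrite !coefD !coefCM /M mul_polyC !linearP /= -mul_polyC linL; ring.
- rewrite addn0 in NdK; rewrite {N}NdK expr0 mul1r.
  rewrite [X in _ + _ * X + _]nth_default; last first.
    by apply: leq_trans (size_xfactor_exp _) _; lia.
  have x0 : xfactor.[0] = 1.
    by rewrite /xfactor hornerD hornerM hornerXn hornerE hornerC expr0n mulr0 addr0.
  by rewrite -horner_coef0 horner_exp x0 expr1n mulr1 mulr0 addr0 addNr.
- rewrite exprS -mulrA shift ?Lx //; first by lia.
  apply: (leq_trans (size_XnM _ _)).
  by have := size_xfactor_exp N; lia.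
- rewrite addn0 in NdK; rewrite {N}NdK expr1 !coefXM addn3 /= mulr0.
  have -> : (yfactor ^+ K.+1)`_(2 * K).+2 = 1.
    have /monicP := yfactor_exp_monic K.+1; rewrite lead_coefE size_yfactor_exp /=.
    by rewrite mulnS.
  by rewrite /be mulr1 add0r addNr.
- rewrite exprS -mulrA shift ?Ly //; first by lia.
  apply: (leq_trans (size_XnM _ _)).
  by rewrite size_yfactor_exp; lia.
Qed.

Variables (K : nat) (L : {poly F} -> F).
Hypothesis momentL : moment_functional K L.

Lemma mf_linear (c : F) (f g : {poly F}) : L (c%:P * f + g) = c * L f + L g.
Proof. by case: momentL. Qed.

Lemma mf_xfactor_exp (N d : nat) :
  (N + d = K)%N -> L ('X^d * xfactor ^+ N) = (N == 0%N)%:R.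
Proof. by case: momentL => _ + _; apply. Qed.

Lemma mf_yfactor_exp (N d : nat) :
  (N + d = K)%N -> L ('X^(d.+1) * yfactor ^+ N) = (N == 0%N)%:R.
Proof. by case: momentL => _ _; apply. Qed.

Lemma mf_add (f g : {poly F}) : L (f + g) = L f + L g.
Proof. by have := mf_linear 1 f g; rewrite !mul1r. Qed.

Lemma mf_0 : L 0 = 0.
Proof. by apply: (addrI (L 0)); rewrite -mf_add !addr0. Qed.

Lemma mf_scale (c : F) (f : {poly F}) : L (c%:P * f) = c * L f.
Proof. by have := mf_linear c f 0; rewrite mf_0 !addr0. Qed.

Lemma mf_sub (f g : {poly F}) : L (f - g) = L f - L g.
Proof.
by rewrite addrC -mulN1r -(polyCN 1%R) mf_linear mulN1r addrC.
Qed.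

Lemma mf_sum (I : Type) (r : seq I) (P : pred I) (f : I -> {poly F}) :
  L (\sum_(i <- r | P i) f i) = \sum_(i <- r | P i) L (f i).
Proof. exact: (big_morph L mf_add mf_0). Qed.

(** Under [L] the sums in [first_letter_enumS] telescope. Each of the two statements uses the other
    one at [n], as the type alternates. *)
Lemma mf_first_letter (n k d : nat) : (k <= n)%N -> (n + d = K)%N ->
    L ('X^d * (xfactor ^+ k * yfactor ^+ (n - k)))
      = (1 - q) ^+ n * first_letter_enum F q true n k
  /\ L ('X^(d.+1) * (xfactor ^+ k * yfactor ^+ (n - k)))
      = (1 - q) ^+ n * first_letter_enum F q false n k.
Proof.
elim: n k d => [|n IH] k d le_kn ndK.
  move: le_kn; rewrite leqn0 => /eqP ->.
  rewrite !first_letter_enum00 subnn !expr0 !mulr1.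
  have := mf_xfactor_exp _ _ ndK; have := mf_yfactor_exp _ _ ndK.
  by rewrite !expr0 !mulr1.
have ndK' : (n + d.+1 = K)%N by rewrite -ndK addnS.
split.
  (* Differences of [f] come from [yfactor - xfactor = (1 - q) 'X^2]; the endpoint [xfactor ^+ n.+1]
     is killed by [L]. *)
  pose f l := - (xfactor ^+ l * yfactor ^+ (n.+1 - l)).
  have step l : (k <= l < n.+1)%N ->
      (1 - q) ^+ n.+1 * first_letter_enum F q false n l = L ('X^d * (f l.+1 - f l)).
    case/andP=> _ le_ln; have [_ IHl] := IH l d.+1 le_ln ndK'.
    rewrite exprS -mulrA -IHl -mf_scale; congr L.
    rewrite /f subSS subSn // !exprS polyCB /xfactor /yfactor; ring.
  rewrite first_letter_enumS //= (eq_bigr (fun l : 'I_n.+1 =>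
    first_letter_enum F q false n l)) => [|l le_kl]; last first.
    by rewrite (eqP (leqW le_kl : (k - l.+1 == 0)%N)) mul1r.
  rewrite -(big_geq_mkord _ _ predT (first_letter_enum F q false n)) big_distrr /=.
  rewrite (eq_big_nat _ _ step) -mf_sum -big_distrr /= telescope_sumr //.
  rewrite /f subnn mulr1 opprK addrC mulrBr mf_sub (mf_xfactor_exp n.+1) //.
  by rewrite subr0.
(* Here [xfactor - q yfactor = 1 - q] is used, and [L] kills the endpoint at l = 0, a multiple of
   [yfactor ^+ n.+1]. *)
pose f l := (q ^+ (k - l))%:P * (xfactor ^+ l * yfactor ^+ (n.+1 - l)).
have step l : (0 <= l < k)%N ->
    (1 - q) ^+ n.+1 * (q ^+ (k - l.+1) * first_letter_enum F q true n l)
      = L ('X^(d.+1) * (f l.+1 - f l)).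
  move=> lt_lk; have le_ln : (l <= n)%N by rewrite -ltnS (leq_trans lt_lk).
  have [IHl _] := IH l d.+1 le_ln ndK'.
  rewrite exprS mulrACA -IHl -mulrA -!mf_scale; congr L.
  rewrite /f subSS subSn // -(subnSK lt_lk) !exprS !polyCM polyCB /xfactor /yfactor; ring.
rewrite first_letter_enumS //=.
rewrite -(big_ord_widen _ (fun l => q ^+ (k - l.+1) * first_letter_enum F q true n l)) //.
rewrite -(big_mkord predT (fun l => q ^+ (k - l.+1) * first_letter_enum F q true n l)).
rewrite big_distrr /= (eq_big_nat _ _ step) -mf_sum -big_distrr /= telescope_sumr //.
rewrite /f subnn expr0 polyC1 mul1r !subn0 mul1r mulrBr mf_sub [X in _ - L X]mulrCA.
by rewrite mf_scale mf_yfactor_exp // mulr0 subr0.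
Qed.

(* s^m R_m *)
Fixpoint newton_prod (m : nat) : {poly F} :=
  if m isn't m'.+1 then 1 else
  if m' isn't m''.+1 then yfactor else
  newton_prod m'' * ((1 + (q ^+ m')%:P * 'X^2) * ('X^2 + (q ^+ m')%:P)).

Lemma newton_prodSS (m : nat) : newton_prod m.+2 =
  newton_prod m * ((1 + (q ^+ m.+1)%:P * 'X^2) * ('X^2 + (q ^+ m.+1)%:P)).
Proof. by []. Qed.

(** With a = q^(m+1), the factor added by [newton_prodSS] is [a yfactor^2 + (1-a)^2 'X^2], so the
    product expands into positive powers of y times s. *)
Lemma mf_yfactor_newton_prod (m d j : nat) : (d + m + j.+1 = K)%N ->
  L ('X^(d.+1) * (yfactor ^+ j.+1 * newton_prod m)) = 0.
Proof.
elim/ltn_ind: m d j => -[|[|m]] IH d j dmjK.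
- by rewrite mulr1 mf_yfactor_exp //; lia.
- by rewrite -exprSr mf_yfactor_exp //; lia.
rewrite newton_prodSS; move: (q ^+ m.+1) => a.
have -> : 'X^(d.+1) * (yfactor ^+ j.+1 * (newton_prod m *
      ((1 + a%:P * 'X^2) * ('X^2 + a%:P)))) =
    a%:P * ('X^(d.+1) * (yfactor ^+ j.+3 * newton_prod m)) +
    ((1 - a) ^+ 2)%:P * ('X^(d.+3) * (yfactor ^+ j.+1 * newton_prod m)).
  rewrite polyC_exp polyCB !exprS /yfactor; ring.
by rewrite mf_add !mf_scale !IH ?mulr0 ?addr0 //; lia.
Qed.

(** The pairing is shifted: ['X^2 + a] combines with the next factor [1 + q^2 a 'X^2] into
    [a xfactor^2 + (1-qa)^2 'X^2], so only positive powers of x arise. *)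
Lemma mf_xfactor_newton_prod (m d j : nat) : (d + m + j.+2 = K)%N ->
  L ('X^d * (xfactor ^+ j.+1 * (newton_prod m * (1 + (q ^+ m.+1)%:P * 'X^2)))) = 0.
Proof.
elim/ltn_ind: m d j => -[|[|m]] IH d j dmjK.
- by rewrite mul1r expr1 -exprSr mf_xfactor_exp //; lia.
- have -> : 'X^d * (xfactor ^+ j.+1 * (newton_prod 1 * (1 + (q ^+ 2)%:P * 'X^2))) =
      'X^d * xfactor ^+ j.+3 +
      ((1 - q) ^+ 2)%:P * ('X^(d.+2) * xfactor ^+ j.+1).
    rewrite !polyC_exp polyCB !exprS /= /yfactor /xfactor; ring.
  rewrite mf_add mf_scale !mf_xfactor_exp ?mulr0 ?addr0 //; lia.
have -> : 'X^d * (xfactor ^+ j.+1 * (newton_prod m.+2 * (1 + (q ^+ m.+3)%:P * 'X^2))) =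
    (q ^+ m.+1)%:P * ('X^d * (xfactor ^+ j.+3 *
      (newton_prod m * (1 + (q ^+ m.+1)%:P * 'X^2)))) +
    ((1 - q ^+ m.+2) ^+ 2)%:P * ('X^(d.+2) * (xfactor ^+ j.+1 *
      (newton_prod m * (1 + (q ^+ m.+1)%:P * 'X^2)))).
  rewrite newton_prodSS !(polyC_exp, polyCB) !exprS /xfactor; ring.
by rewrite mf_add !mf_scale !IH ?mulr0 ?addr0 //; lia.
Qed.

Lemma mf_newton_prodSS (m d : nat) : (m.+2 + d = K)%N ->
  L ('X^d * newton_prod m.+2) =
    (1 - q ^+ m.+1) * (1 - q ^+ m.+2) * L ('X^(d.+2) * newton_prod m).
Proof.
move=> mdK; have Lx : (d + m + 2 = K)%N by lia.
have Ly : (d.+1 + m + 1 = K)%N by lia.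
rewrite [q ^+ m.+2]exprS.
(* The new factor is split so that the two preceding lemmas kill all but a constant multiple of
   ['X^2]. *)
have -> : 'X^d * newton_prod m.+2 =
    (q ^+ m.+1)%:P * ('X^d * (xfactor ^+ 1 * (newton_prod m * (1 + (q ^+ m.+1)%:P * 'X^2)))) +
    ((q ^+ m.+1 - q ^+ m.+1 ^+ 2 * q)%:P * ('X^(d.+2) * (yfactor ^+ 1 * newton_prod m)) +
    ((1 - q ^+ m.+1) * (1 - q * q ^+ m.+1))%:P * ('X^(d.+2) * newton_prod m)).
  rewrite newton_prodSS; move: (q ^+ m.+1) => a.
  rewrite !(polyCM, polyCB, polyC1) !exprS /xfactor /yfactor; ring.
rewrite !mf_add !mf_scale (mf_xfactor_newton_prod _ _ _ Lx).
by rewrite (mf_yfactor_newton_prod _ _ _ Ly) !mulr0 !add0r.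
Qed.

Lemma mf_newton_prod (m d : nat) : (m + d = K)%N ->
  L ('X^d * newton_prod m) = \prod_(i < m) (1 - q ^+ i.+1).
Proof.
elim/ltn_ind: m d => -[|[|m]] IH d mdK.
- by rewrite big_ord0 (mf_xfactor_exp 0).
- rewrite big_ord1 expr1.
  have -> : 'X^d * newton_prod 1 =
      'X^d * xfactor ^+ 1 + (1 - q)%:P * ('X^(d.+2) * yfactor ^+ 0).
    rewrite !polyCB !exprS /= /xfactor /yfactor; ring.
  by rewrite mf_add mf_scale mf_xfactor_exp // mf_yfactor_exp // add0r mulr1.
rewrite mf_newton_prodSS // IH //; last by rewrite -mdK !addnS.
rewrite 2!big_ord_recr /=; ring.
Qed.

End MomentFunctional.

(** * Newton interpolation *)

(** The recursion makes [c n M] the complete homogeneous symmetric polynomial of degree n-M in z_0,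
    ..., z_M. It is matched by multiplying each term by u = z_M v + (u - z_M v); [v] homogenizes. *)
Lemma newton_expansion (R : comPzRingType) (z : nat -> R) (c : nat -> nat -> R)
    (u v : R) (N : nat) :
  c 0%N 0%N = 1 -> (forall M, c 0%N M.+1 = 0) ->
  (forall n, c n.+1 0%N = z 0%N * c n 0%N) ->
  (forall n M, c n.+1 M.+1 = z M.+1 * c n M.+1 + c n M) ->
  u ^+ N = \sum_(M < N.+1) c N M * (v ^+ (N - M) * \prod_(l < M) (u - z l * v)).
Proof.
move=> c00 c0S cS0 cSS.
have c_gt n M : (n < M)%N -> c n M = 0.
  elim: n M => [|n IH] [|M] //= lt_nM.
  by rewrite cSS !IH ?mulr0 ?addr0 // ltnW.
elim: N => [|N IH]; first by rewrite big_ord1 c00 subnn big_ord0 !mulr1.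
pose A M := z M * c N M * (v ^+ (N.+1 - M) * \prod_(l < M) (u - z l * v)).
pose B M := c N M * (v ^+ (N - M) * \prod_(l < M.+1) (u - z l * v)).
rewrite exprS IH big_distrr /= (eq_bigr (fun M : 'I_N.+1 => A M + B M)) => [|M _]; last first.
  by rewrite /A /B big_ord_recr /= subSn -1?ltnS // exprS; ring.
rewrite big_split /= [RHS]big_ord_recl cS0.
rewrite [X in _ = _ + X](eq_bigr (fun M : 'I_N.+1 => A M.+1 + B M)) => [|M _]; last first.
  by rewrite /= /bump add1n cSS /A /B subSS mulrDl.
rewrite big_split /= addrA; congr (_ + _).
have -> : \sum_(M < N.+1) A M = \sum_(M < N.+2) A M.
  have A0 : A N.+1 = 0 by rewrite /A c_gt // mulr0 mul0r.
  by rewrite [RHS]big_ord_recr /= A0 addr0.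
by rewrite big_ord_recl.
Qed.

Section DividedDifference.
Variable F : fieldType.

Definition node_prod (z : nat -> F) (M l : nat) : F :=
  \prod_(i < M | nat_of_ord i != l) (z l - z i).

(** The Lagrange form over M+1 nodes, whose summands become those of the inner sum over k. *)
Definition divided_difference (z w : nat -> F) (M : nat) : F :=
  \sum_(l < M.+1) w l / node_prod z M.+1 l.

Lemma divided_difference_recr (z w : nat -> F) (M : nat) :
  (forall i j, (i < j)%N -> z j != z i) ->
  divided_difference z (fun l => (z l - z M.+1) * w l) M.+1 =
    divided_difference z w M.
Proof.
move=> zneq; rewrite /divided_difference big_ord_recr /= subrr !mul0r addr0.
apply: eq_bigr => l _; rewrite /node_prod big_mkcond big_ord_recr -big_mkcond /=.
rewrite gtn_eqF //= [_ * w l]mulrC -mulf_div mulfV ?mulr1 //.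
by rewrite subr_eq0 eq_sym zneq.
Qed.

Lemma divided_difference_recl (z w : nat -> F) (M : nat) :
  (forall i j, (i < j)%N -> z j != z i) ->
  divided_difference z (fun l => (z l - z 0%N) * w l) M.+1 =
    divided_difference (fun l => z l.+1) (fun l => w l.+1) M.
Proof.
move=> zneq; rewrite /divided_difference big_ord_recl /= subrr !mul0r add0r.
apply: eq_bigr => l _; rewrite /node_prod big_mkcond big_ord_recl -big_mkcond /=.
by rewrite -mulf_div mulfV ?mul1r ?subr_eq0 ?zneq.
Qed.

Lemma divided_difference_linear (z : nat -> F) (a b : F) (w w' : nat -> F) (M : nat) :
  divided_difference z (fun l => a * w l + b * w' l) M =
    a * divided_difference z w M + b * divided_difference z w' M.
Proof.
rewrite /divided_difference !big_distrr -big_split /=; apply: eq_bigr => l _.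
by rewrite mulrDl !mulrA.
Qed.

(** The weights z_l - z_0 and z_l - z_(M+1) differ by a nonzero constant, and each lowers the order
    by dropping an end node; the two results agree by induction. *)
Lemma divided_difference_const (z : nat -> F) (M : nat) :
  (forall i j, (i < j)%N -> z j != z i) ->
  divided_difference z (fun=> 1) M = (M == 0%N)%:R.
Proof.
elim: M z => [|M IH] z zneq.
  by rewrite /divided_difference big_ord1 /node_prod big_mkcond big_ord1 divr1.
have dz : z M.+1 - z 0%N != 0 by rewrite subr_eq0 zneq.
apply: (mulfI dz); rewrite mulr0.
have -> : (z M.+1 - z 0%N) * divided_difference z (fun=> 1) M.+1 =
    1 * divided_difference z (fun l => (z l - z 0%N) * 1) M.+1
    + (-1) * divided_difference z (fun l => (z l - z M.+1) * 1) M.+1.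
  rewrite -divided_difference_linear {1}/divided_difference big_distrr /=.
  by apply: eq_bigr => l _; rewrite mulrA; congr (_ / _); ring.
rewrite divided_difference_recl // divided_difference_recr // !IH //.
  by rewrite mul1r mulN1r subrr.
by move=> i j ij; apply: zneq.
Qed.

Lemma newton_interpolation (z : nat -> F) (u v : {poly F}) (N : nat) :
  (forall i j, (i < j)%N -> z j != z i) ->
  u ^+ N = \sum_(M < N.+1) (divided_difference z (fun l => z l ^+ N) M)%:P *
    (v ^+ (N - M) * \prod_(l < M) (u - (z l)%:P * v)).
Proof.
move=> zneq; pose c n M := divided_difference z (fun l => z l ^+ n) M.
apply: (newton_expansion _ (fun l => (z l)%:P) (fun n M => (c n M)%:P)).
- by rewrite /c divided_difference_const.
- by move=> M; rewrite /c divided_difference_const.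
- move=> n; rewrite -polyCM /c /divided_difference !big_ord1 exprS.
  by rewrite mulrA.
- move=> n M; rewrite -polyCM -polyCD; congr polyC.
  (* This rests on z^(n+1) = z_(M+1) z^n + (z - z_(M+1)) z^n. *)
  rewrite /c -(divided_difference_recr z (fun l => z l ^+ n) M) // -[X in _ + X]mul1r.
  rewrite -divided_difference_linear.
  by apply: eq_bigr => l _; congr (_ / _); rewrite exprS; ring.
Qed.

End DividedDifference.

(** * The closed form *)

Section ClosedForm.
Variables (F : fieldType) (q : F).
Hypotheses (q_neq0 : q != 0) (q_nroot : forall j, (0 < j)%N -> q ^+ j != 1).

(* Newton node for (yfactor / 'X)^2 *)
Definition node (j : nat) : F := - ((1 - q ^+ j) ^+ 2 / q ^+ j).

Lemma subr1_qint (j : nat) : 1 - q ^+ j = (1 - q) * qint q j.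
Proof. by rewrite -opprB subrX1 -mulNr opprB. Qed.

(** As [node j] is 2 - q^j - q^(-j), differences factor; this separates the nodes and yields
    q-Pochhammer symbols. *)
Lemma node_sub (i j : nat) : (i <= j)%N ->
  node j - node i = - ((1 - q ^+ (j - i)) * (1 - q ^+ (j + i)) / q ^+ j).
Proof.
move=> le_ij; have [d ->] : exists d, j = (i + d)%N by exists (j - i)%N; rewrite subnKC.
rewrite /node addKn addnAC !exprD; move: (expf_neq0 i q_neq0) (expf_neq0 d q_neq0).
by move: (q ^+ i) (q ^+ d) => a b a0 b0; field; rewrite a0 b0.
Qed.

Lemma node_neq (i j : nat) : (i < j)%N -> node j != node i.
Proof.
move=> lt_ij; rewrite -subr_eq0 node_sub 1?ltnW // oppr_eq0 !mulf_eq0 invr_eq0.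
rewrite expf_eq0 (negPf q_neq0) andbF orbF !subr_eq0 ![1 == _]eq_sym.
by rewrite !(negPf (q_nroot _ _)) // ?subn_gt0 // ltn_addr // (leq_ltn_trans _ lt_ij).
Qed.

Lemma qpoch_neq0 (a b k : nat) : (0 < a)%N -> qpoch (q ^+ a) (q ^+ b) k != 0.
Proof.
move=> a0; apply/prodf_neq0 => i _; rewrite subr_eq0 eq_sym -exprM -exprD.
by rewrite q_nroot // ltn_addr.
Qed.

Lemma qpoch2E (k : nat) : qpoch (q ^+ 2) (q ^+ 2) k = \prod_(i < k) (1 - q ^+ (2 * i.+1)).
Proof. by apply: eq_bigr => i _; rewrite -exprS -exprM. Qed.

Lemma prod_expr_affine (c k : nat) :
  \prod_(i < k) q ^+ (2 * i + c.+1) = q ^+ (k ^ 2 + k * c).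
Proof.
elim: k => [|k IH]; first by rewrite big_ord0.
rewrite big_ord_recr /= IH -exprD; congr (_ ^+ _); ring.
Qed.

(** The factors below and above index [l] give two Pochhammer symbols each; the sign comes from
    those below. *)
Lemma node_prod_closed (e l k : nat) :
  node_prod F (fun i => node (2 * i + e.+1)) (l + k).+1 l =
    (-1) ^+ l / (q ^+ (l * (2 * l + e.+1)) * q ^+ (k ^ 2 + k * (2 * l + e + 2)))
    * (qpoch (q ^+ 2) (q ^+ 2) k * qpoch (q ^+ 2) (q ^+ 2) l
       * qpoch (q ^+ (2 * (2 * l + e + 2))) (q ^+ 2) k
       * qpoch (q ^+ (2 * (l + e + 1))) (q ^+ 2) l).
Proof.
rewrite /node_prod -addnS big_mkcond big_split_ord big_ord_recl /= addn0 eqxx mul1r.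
have -> : \prod_(i < l) (if i != l :> nat then node (2 * l + e.+1) - node (2 * i + e.+1) else 1)
    = (-1) ^+ l / q ^+ (l * (2 * l + e.+1)) *
      (qpoch (q ^+ 2) (q ^+ 2) l * qpoch (q ^+ (2 * (l + e + 1))) (q ^+ 2) l).
  rewrite (eq_bigr (fun i : 'I_l => - (q ^+ (2 * l + e.+1))^-1 *
    ((1 - q ^+ (2 * (l - i))) * (1 - q ^+ (2 * (l + e + 1)) * q ^+ 2 ^+ i)))); last first.
    move=> i _; rewrite (ltn_eqF (ltn_ord i)) /= node_sub; last first.
      by have := ltn_ord i; lia.
    rewrite -exprM -exprD mulNr mulrC; congr (- (_ * ((1 - q ^+ _) * (1 - q ^+ _)))).
      by have := ltn_ord i; lia.
    by have := ltn_ord i; lia.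
  rewrite !big_split /= prodr_const card_ord [in LHS]exprNn exprVn -exprM qpoch2E.
  rewrite [((2 * l + e.+1) * l)%N]mulnC; congr (_ * (_ * _)).
  rewrite (reindex_inj rev_ord_inj) /=; apply: eq_bigr => i _.
  by rewrite subKn.
have -> : \prod_(i < k) (if (l + bump 0 i)%N != l then
      node (2 * l + e.+1) - node (2 * (l + bump 0 i) + e.+1) else 1)
    = (q ^+ (k ^ 2 + k * (2 * l + e + 2)))^-1 *
      (qpoch (q ^+ 2) (q ^+ 2) k * qpoch (q ^+ (2 * (2 * l + e + 2))) (q ^+ 2) k).
  rewrite (eq_bigr (fun i : 'I_k => (q ^+ (2 * i + (2 * l + e + 2).+1))^-1 *
    ((1 - q ^+ (2 * i.+1)) * (1 - q ^+ (2 * (2 * l + e + 2)) * q ^+ 2 ^+ i)))); last first.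
    move=> i _; rewrite /bump add1n -[X in _ != X]addn0 eqn_add2l /=.
    rewrite -opprB node_sub; last by lia.
    rewrite opprK -exprM -exprD mulrC.
    by congr ((q ^+ _)^-1 * ((1 - q ^+ _) * (1 - q ^+ _))); lia.
  by rewrite !big_split /= prodfV prod_expr_affine qpoch2E.
by rewrite invfM; ring.
Qed.

Definition En_rhs_term (e M N k : nat) : F :=
  ((-1) ^+ (N - M + k) * (1 - q) ^+ (2 * M)
    * qint q (2 * (M - k) + e.+1) ^+ (2 * N) * q ^ Aexp (2 * N + e) (2 * M + e) k)
  / (qpoch (q ^+ 2) (q ^+ 2) k * qpoch (q ^+ 2) (q ^+ 2) (M - k)
     * qpoch (q ^+ (2 * (2 * (M - k) + e + 2))) (q ^+ 2) k
     * qpoch (q ^+ (2 * (M - k + e + 1))) (q ^+ 2) (M - k)).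

(** Trades a possibly negative exponent for natural ones, within reach of [ring]. *)
Lemma expfz_balance (A : int) (u w a b : nat) :
  A + (u + w)%:Z = (a + b)%:Z -> q ^ A = (q ^+ w)^-1 * ((q ^+ u)^-1 * (q ^+ a * q ^+ b)).
Proof.
move=> bal; apply: (mulIf (expf_neq0 (u + w) q_neq0)).
rewrite [in LHS]exprnP -expfzDr // bal -exprnP !exprD.
move: (expf_neq0 u q_neq0) (expf_neq0 w q_neq0); move: (q ^+ u) (q ^+ w) => qu qw u0 w0.
by field; rewrite u0 w0.
Qed.

Lemma half_double_add (e M : nat) : (e <= 1)%N -> ((2 * M + e)./2 = M)%N.
Proof. by case: e => [|[|]] // _; rewrite mul2n ?addn0 ?addn1 /= ?uphalf_double ?doubleK. Qed.

(** The terms added to [Aexp] are the exponents in the denominator of [node ^+ N] and in the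
    constant of [newton_prod_nodes]; the right side comes from [node_prod_closed]. *)
Lemma Aexp_balance (e l k d : nat) (M := (l + k)%N) (N := (l + k + d)%N) :
  (e <= 1)%N ->
  Aexp (2 * N + e) (2 * M + e) k
    + ((2 * l + e.+1) * N + (M ^ 2 + M * e))%:Z
  = (l * (2 * l + e.+1) + (k ^ 2 + k * (2 * l + e + 2)))%:Z.
Proof.
move=> e1; rewrite /Aexp !half_double_add // -!mulnn.
have -> : (2 * N + e - (2 * M + e) = 2 * d)%N by rewrite /N /M; lia.
by rewrite mul2n doubleK /N /M; lia.
Qed.

Lemma node_exp (j N : nat) : node j ^+ N =
  (-1) ^+ N * ((1 - q) ^+ (2 * N) * qint q j ^+ (2 * N)) / q ^+ (j * N).
Proof.
rewrite /node subr1_qint [LHS]exprNn expr_div_n !exprMn -!exprM.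
by rewrite mul2n -addnn !exprD; ring.
Qed.

Lemma En_rhs_termE (e M N k : nat) : (e <= 1)%N -> (k <= M)%N -> (M <= N)%N ->
  (1 - q) ^+ (2 * N + e) * En_rhs_term e M N k =
  (1 - q) ^+ (2 * M + e) / q ^+ (M ^ 2 + M * e) *
    (node (2 * (M - k) + e.+1) ^+ N /
      node_prod F (fun i => node (2 * i + e.+1)) M.+1 (M - k)).
Proof.
move=> e1 kM MN.
have [l Ml] : exists l, M = (l + k)%N by exists (M - k)%N; rewrite subnK.
have [d Nd] : exists d, N = (l + k + d)%N by exists (N - M)%N; rewrite -Ml subnKC.
have lE : (M - k = l)%N by rewrite Ml addnK.
have EA := expfz_balance _ _ _ _ _ (Aexp_balance e l k d e1).
rewrite -Nd -Ml in EA.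
(* [node ^+ N] contributes (-1)^N and [node_prod] contributes (-1)^l; the exponents differ by 2l. *)
have sgn : (-1) ^+ (N - M + k) = (-1) ^+ N * (-1) ^+ l :> F.
  have -> : (N - M + k = d + k)%N by rewrite Nd Ml addKn.
  rewrite Nd !exprD; have := sqrr_sign F l.
  move: ((-1) ^+ l) ((-1) ^+ k) ((-1) ^+ d) => sl sk sd sl2.
  by rewrite -[LHS]mul1r -sl2; ring.
have NP := node_prod_closed e l k; rewrite -Ml in NP.
rewrite /En_rhs_term lE NP sgn.
rewrite node_exp !invfM !invrK invr_sign EA !(exprD (1 - q)).
ring.
Qed.

(** Each pair of factors is q^j (yfactor^2 - node j X^2) with j = 2l+e+1, and these j add up to M^2
    + Me. *)
Lemma newton_prod_nodes (e M : nat) : (e <= 1)%N ->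
  newton_prod F q (2 * M + e) = (q ^+ (M ^ 2 + M * e))%:P *
    (yfactor F ^+ e * \prod_(l < M) (yfactor F ^+ 2 - (node (2 * l + e.+1))%:P * 'X^2)).
Proof.
move=> e1; elim: M => [|M IH].
  by rewrite big_ord0 polyC1 mul1r mulr1; case: e e1 => [|[]].
have -> : (2 * M.+1 + e = (2 * M + e).+2)%N by lia.
rewrite newton_prodSS IH big_ord_recr /= -addnS.
have -> : (M.+1 ^ 2 + M.+1 * e = M ^ 2 + M * e + (2 * M + e.+1))%N by rewrite -!mulnn; lia.
move: (\prod_(l < M) _) => P.
rewrite [q ^+ (_ + (2 * M + e.+1))]exprD polyCM /node.
move: (expf_neq0 (2 * M + e.+1) q_neq0); move: (q ^+ (2 * M + e.+1)) => a a0.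
suff -> : (1 + a%:P * 'X^2) * ('X^2 + a%:P)
    = a%:P * (yfactor F ^+ 2 - (- ((1 - a) ^+ 2 / a))%:P * 'X^2).
  move: (yfactor F ^+ 2 - _) (yfactor F ^+ e) ((q ^+ _)%:P) => u v c.
  by ring.
rewrite mulrBr [X in _ - X]mulrA -polyCM.
have -> : a * - ((1 - a) ^+ 2 / a) = - (1 - a) ^+ 2 by field.
rewrite !(polyCN, polyC_exp, polyCB, polyC1) /yfactor; ring.
Qed.

Lemma prod_subr1_qfact (m : nat) :
  \prod_(i < m) (1 - q ^+ i.+1) = (1 - q) ^+ m * qfact q m.
Proof.
rewrite /qfact (eq_bigr (fun i : 'I_m => (1 - q) * qint q i.+1)) => [|i _].
  by rewrite big_split /= prodr_const card_ord.
exact: subr1_qint.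
Qed.

Lemma first_letter_closed (e N : nat) : (e <= 1)%N ->
  first_letter_enum F q true (2 * N + e) 0 =
    \sum_(M < N.+1) qfact q (2 * M + e) * \sum_(k < M.+1) En_rhs_term e M N k.
Proof.
move=> e1; have [L momentL] := moment_functional_exists F q (2 * N + e).
have q1 : 1 - q != 0 by rewrite subr_eq0 eq_sym -[q]expr1 q_nroot.
apply: (mulfI (expf_neq0 (2 * N + e) q1)).
have [<- _] := mf_first_letter F q _ L momentL (2 * N + e) 0 0 (leq0n _) (addn0 _).
rewrite !mul1r subn0 exprD exprM mulrC.
(* Only the even part [(yfactor ^+ 2) ^+ N] is interpolated; [yfactor ^+ e] completes the Newton
   products. *)
rewrite (newton_interpolation F (fun l => node (2 * l + e.+1)) (yfactor F ^+ 2) 'X^2 N);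
  last first.
  by move=> i j ij; apply: node_neq; lia.
rewrite !big_distrr /= (mf_sum F q _ L momentL); apply: eq_bigr => M _.
have MN : (M <= N)%N by rewrite -ltnS.
rewrite !big_distrr /=.
have qM := expf_neq0 (M ^ 2 + M * e) q_neq0.
set dd := divided_difference _ _ _ _.
have -> : yfactor F ^+ e * (dd%:P * ('X^2 ^+ (N - M) *
      \prod_(l < M) (yfactor F ^+ 2 - (node (2 * l + e.+1))%:P * 'X^2))) =
    (dd / q ^+ (M ^ 2 + M * e))%:P * ('X^(2 * (N - M)) * newton_prod F q (2 * M + e)).
  rewrite newton_prod_nodes // exprM [RHS]mulrCA mulrA -mulrA mulrA.
  rewrite [_%:P * (_%:P * _)]mulrA -polyCM divfK //; ring.
rewrite (mf_scale F q _ L momentL) (mf_newton_prod F q _ L momentL); last by lia.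
(* The index k of the closed form counts nodes from the top, so l = M - k. *)
rewrite prod_subr1_qfact /dd /divided_difference (reindex_inj rev_ord_inj) /=.
rewrite !big_distrl /=; apply: eq_bigr => k _; rewrite subSS.
have kM : (k <= M)%N by rewrite -ltnS.
rewrite [RHS]mulrCA (En_rhs_termE _ _ _ _ e1 kM MN); ring.
Qed.

Lemma sum_same_parity (e N : nat) (f : nat -> F) : 2 != 0 :> F ->  (e <= 1)%N ->
  \sum_(m < (2 * N + e).+1) (1 + (-1) ^+ (2 * N + e - m)) / 2 * f m =
    \sum_(M < N.+1) f (2 * M + e)%N.
Proof.
move=> two e1; elim: N => [|N IH].
  case: e e1 => [|[]] // _; rewrite ?big_ord_recr !big_ord0 /=.
    by rewrite expr0 add0r -[1 + 1]/2 divff // mul1r add0r.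
  by rewrite subnn expr0 expr1 subrr mul0r mul0r !add0r -[1 + 1]/2 divff // mul1r.
have -> : (2 * N.+1 + e = (2 * N + e).+2)%N by lia.
rewrite 2![in LHS]big_ord_recr [RHS]big_ord_recr /= -IH.
rewrite subnn subSnn expr0 expr1 subrr !mul0r addr0 -[1 + 1]/2 divff // mul1r.
have -> : (2 * N.+1 + e = (2 * N + e).+2)%N by lia.
congr (_ + _); apply: eq_bigr => m _.
have -> : ((2 * N + e).+2 - m = (2 * N + e - m).+2)%N by have := ltn_ord m; lia.
by rewrite !exprS mulN1r mulN1r opprK.
Qed.

Lemma En_rhs_closed (n : nat) : 2 != 0 :> F ->
  first_letter_enum F q true n 0 = En_rhs q n.
Proof.
move=> two; have [e [N [e1 ->]]] : exists e N, (e <= 1)%N /\ n = (2 * N + e)%N.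
  exists (odd n), n./2; split; first by case: odd.
  by rewrite mul2n addnC odd_double_half.
pose f m := qfact q m * \sum_(k < (m./2).+1)
  ((-1) ^+ ((2 * N + e - m)./2 + k) * (1 - q) ^+ (2 * m./2)
    * qint q (m - 2 * k + 1) ^+ (2 * (2 * N + e)./2) * q ^ (Aexp (2 * N + e) m k))
  / (qpoch (q ^+ 2) (q ^+ 2) k * qpoch (q ^+ 2) (q ^+ 2) (m./2 - k)
     * qpoch (q ^+ (2 * (m - 2 * k + 2))) (q ^+ 2) k
     * qpoch (q ^+ (2 * ((m.+1)./2 - k + 1))) (q ^+ 2) (m./2 - k)).
transitivity (\sum_(M < N.+1) f (2 * M + e)%N).
  rewrite first_letter_closed //; apply: eq_bigr => M _.
  have MN : (M <= N)%N by rewrite -ltnS.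
  rewrite /f half_double_add //; congr (_ * _); apply: eq_bigr => k _.
  have kM : (k <= M)%N by rewrite -ltnS.
  rewrite half_double_add // /En_rhs_term.
  have -> : ((2 * M + e).+1./2 = M + e)%N.
    case: e e1 {f} => [|[]] // _; first by rewrite addn0 -addn1 half_double_add ?addn0.
    by rewrite (_ : (2 * M + 1).+1 = 2 * M.+1 + 0)%N ?half_double_add ?addn1 //; lia.
  have -> : ((2 * N + e - (2 * M + e))./2 = N - M)%N.
    by rewrite subnDr -mulnBr mul2n doubleK.
  have -> : (2 * M + e - 2 * k + 1 = 2 * (M - k) + e.+1)%N by lia.
  have -> : (2 * M + e - 2 * k + 2 = 2 * (M - k) + e + 2)%N by lia.
  by have -> : (M + e - k + 1 = M - k + e + 1)%N by lia.
rewrite -(sum_same_parity e N f) //; apply: eq_bigr => m _.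
by rewrite /f mulrA.
Qed.

End ClosedForm.

(* Identity of rational functions in q: both sides live in the field of
   fractions of Q[q], with q := 'X. *)
Theorem theorem7p1 (n : nat) :
  toF (En n) = En_rhs (toF 'X) n.
Proof.
have q_neq0 : toF 'X != 0 by rewrite /toF tofrac_eq0 polyX_eq0.
have q_nroot j : (0 < j)%N -> toF 'X ^+ j != 1.
  move=> j0; rewrite /toF -tofracXn -tofrac1 tofrac_eq.
  apply/eqP => /(congr1 (fun p : {poly rat} => size p)).
  by rewrite size_polyXn size_poly1; case: j j0.
have two_neq0 : (2 : {fraction {poly rat}}) != 0.
  by rewrite -[2]/(2%:R) -tofrac1 -tofracMn tofrac_eq0 -polyC1 -polyCMn polyC_eq0.
rewrite -(En_rhs_closed _ _ q_neq0 q_nroot n two_neq0).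
rewrite -sum_falling_alt_first_letter /En /toF rmorph_sum /=.
by apply: eq_bigr => s _; rewrite tofracXn.
Qed.
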